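(* The functor $F:\mathbf{Set}^m\to\mathbf{QAb}^m$ is left adjoint to the forgetful functor $U:\mathbf{QAb}^m\to\mathbf{Set}^m$.
   Context: $\mathbf{Set}^m$ is the category whose objects are injective set maps $i:X'\to X$ and whose morphisms $(i:X'\to X)\to(j:Y'\to Y)$ are pairs $(f_1,f_2)$ of set maps $f_1:X\to Y$, $f_2:X'\to Y'$ with $j\circ f_2=f_1\circ i$, composed componentwise. For an abelian group $G$, $U'G$ denotes its underlying monoid (forgetting inverses). $\mathbf{QAb}^m$ is the category whose objects are injective monoid homomorphisms $i:M\to U'G$, with $M$ a monoid and $G$ an abelian group, and whose morphisms $(i:M\to U'G)\to(j:N\to U'H)$ are pairs $(f_1,f_2)$ with $f_1:G\to H$ a group homomorphism and $f_2:M\to N$ a monoid homomorphism such that $j\circ f_2=U'f_1\circ i$, composed componentwise. $U$ sends $i:M\to U'G$ to its underlying injective set map, and sends morphisms to the underlying pairs of set maps. $F$ sends $i:X'\to X$ to $Fi:F_2X'\to U'F_1X$, where $F_1X$ is the free abelian group on $X$, $F_2X'$ is the free commutative monoid on $X'$, and $Fi$ is the monoid homomorphism induced by $i$ on generators. $F$ sends a morphism $f=(f_1,f_2)$ to the $\mathbf{QAb}^m$-morphism determined by the group homomorphism $F_1f_1:F_1X\to F_1Y$ (its second component being the monoid homomorphism $F_2X'\to F_2Y'$ induced by $f_2$). *)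

(* Defs.v *)
From HB Require Import structures.
From mathcomp Require Import all_boot all_algebra finmap multiset freeg.
From mathcomp Require Import boolp.

Set Implicit Arguments.
Unset Strict Implicit.
Unset Printing Implicit Defensive.

Import GRing.Theory.
Local Open Scope ring_scope.

Record category := Category {
  obj :> Type;
  hom : obj -> obj -> Type;
  idc : forall a, hom a a;
  compc : forall a b c, hom b c -> hom a b -> hom a c;
  comp1c : forall a b (f : hom a b), compc (idc b) f = f;
  compc1 : forall a b (f : hom a b), compc f (idc a) = f;
  compcA : forall a b c d (h : hom c d) (g : hom b c) (f : hom a b),
    compc h (compc g f) = compc (compc h g) f
}.

Record functor (C D : category) := Functor {
  fobj :> C -> D;
  fmor : forall a b, hom a b -> hom (fobj a) (fobj b);
  fmor1 : forall a, fmor (idc a) = idc (fobj a);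
  fmorM : forall a b c (g : hom b c) (f : hom a b),
    fmor (compc g f) = compc (fmor g) (fmor f)
}.

Definition left_adjoint (C D : category) (F : functor C D) (U : functor D C) :=
  exists phi : forall (a : C) (b : D), hom (F a) b -> hom a (U b),
    [/\ forall a b, bijective (phi a b),
        forall a a' b (f : hom a' a) (g : hom (F a) b),
          phi a' b (compc g (fmor F f)) = compc (phi a b g) f
      & forall a b b' (g : hom (F a) b) (h : hom b b'),
          phi a b' (compc h g) = compc (fmor U h) (phi a b g)].

Record setm_obj := SetmObj {
  ssub : Type;
  samb : Type;
  smap : ssub -> samb;
  smap_inj : injective smap
}.
Arguments smap : clear implicits.

Record setm_hom (i j : setm_obj) := SetmHom {
  shom1 : samb i -> samb j;
  shom2 : ssub i -> ssub j;
  shomE : smap j \o shom2 = shom1 \o smap i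
}.

Lemma setm_homP (i j : setm_obj) (f g : setm_hom i j) :
  shom1 f = shom1 g -> shom2 f = shom2 g -> f = g.
Proof.
case: f g => [f1 f2 fE] [g1 g2 gE] /= e1 e2; subst g1 g2.
by rewrite (Prop_irrelevance fE gE).
Qed.

Definition setm_id (i : setm_obj) : setm_hom i i :=
  @SetmHom i i idfun idfun erefl.

Definition setm_comp (i j k : setm_obj) (g : setm_hom j k) (f : setm_hom i j) :
  setm_hom i k.
Proof.
apply: (@SetmHom i k (shom1 g \o shom1 f) (shom2 g \o shom2 f)).
by rewrite compA shomE -compA shomE compA.
Defined.

Definition Setm : category.
Proof.
apply: (@Category setm_obj setm_hom setm_id setm_comp) => *;
  exact: setm_homP.
Defined.

(* UMagmaMorphism is the structure of the functions preserving 1 and *. *)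
Notation monoid_hom M N := (UMagmaMorphism.type M%type N%type).

(* The underlying monoid of an abelian group: monoidType is multiplicative,  *)
(* so the monoid law of U' G is the addition of G and its unit is 0.          *)
Definition U' (G : zmodType) : Type := G.

Section UnderlyingMonoid.
Variable G : zmodType.
HB.instance Definition _ := Choice.copy (U' G) G.
HB.instance Definition _ :=
  isMonoid.Build (U' G) (@addrA G) (@add0r G) (@addr0 G).
End UnderlyingMonoid.

Definition U'map (G H : zmodType) (f : {additive G -> H}) : U' G -> U' H := f.

Section UnderlyingMonoidMap.
Variables (G H : zmodType) (f : {additive G -> H}).
Fact U'map_monoid_morphism : monoid.monoid_morphism (U'map f).
Proof. by split; [exact: raddf0 | exact: raddfD]. Qed.
HB.instance Definition _ :=
  isUMagmaMorphism.Build (U' G) (U' H) (U'map f) U'map_monoid_morphism.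
End UnderlyingMonoidMap.

Lemma additive_homP (G H : zmodType) (f g : {additive G -> H}) :
  f = g :> (G -> H) -> f = g.
Proof.
case: f g => [f [[fE]]] [g [[gE]]] /= e; subst g.
by rewrite (Prop_irrelevance fE gE).
Qed.

Lemma monoid_homP (M N : monoidType) (f g : monoid_hom M N) :
  f = g :> (M -> N) -> f = g.
Proof.
case: f g => [f [[fE] [fD]]] [g [[gE] [gD]]] /= e; subst g.
by rewrite (Prop_irrelevance fE gE) (Prop_irrelevance fD gD).
Qed.

Record qabm_obj := QAbmObj {
  qsub : monoidType;
  qamb : zmodType;
  qmap : monoid_hom qsub (U' qamb);
  qmap_inj : injective qmap
}.

Record qabm_hom (i j : qabm_obj) := QAbmHom {
  qhom1 : {additive qamb i -> qamb j};
  qhom2 : monoid_hom (qsub i) (qsub j);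
  qhomE : qmap j \o qhom2 = U'map qhom1 \o qmap i
}.

Lemma qabm_homP (i j : qabm_obj) (f g : qabm_hom i j) :
  qhom1 f = qhom1 g :> (_ -> _) -> qhom2 f = qhom2 g :> (_ -> _) -> f = g.
Proof.
case: f g => [f1 f2 fE] [g1 g2 gE] /= /additive_homP e1 /monoid_homP e2.
by subst g1 g2; rewrite (Prop_irrelevance fE gE).
Qed.

Definition qabm_id (i : qabm_obj) : qabm_hom i i :=
  @QAbmHom i i idfun idfun erefl.

Definition qabm_comp (i j k : qabm_obj) (g : qabm_hom j k) (f : qabm_hom i j) :
  qabm_hom i k.
Proof.
apply: (@QAbmHom i k (qhom1 g \o qhom1 f) (qhom2 g \o qhom2 f)).
have gE := qhomE g; have fE := qhomE f.
apply/funext => x; move/(congr1 (@^~ (qhom2 f x))): gE => /= ->.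
by move/(congr1 (@^~ x)): fE => /= ->.
Defined.

Definition QAbm : category.
Proof.
apply: (@Category qabm_obj qabm_hom qabm_id qabm_comp) => *;
  exact: qabm_homP.
Defined.

Definition U_obj (i : qabm_obj) : setm_obj :=
  @SetmObj (qsub i) (qamb i) (qmap i) (@qmap_inj i).

Definition U_mor (i j : qabm_obj) (f : qabm_hom i j) :
  setm_hom (U_obj i) (U_obj j) :=
  @SetmHom (U_obj i) (U_obj j) (qhom1 f) (qhom2 f) (qhomE f).

Definition U : functor QAbm Setm.
Proof. by apply: (@Functor QAbm Setm U_obj U_mor) => *; exact: setm_homP. Defined.

(* {classic X} is X with the classical equality and choice structures that   *)
(* the library's free constructions require.                                  *)
Definition F1 (X : Type) : zmodType := {freeg {classic X}}.

Definition F2 (X : Type) : Type := {mset {classic X}}%mset.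

Section FreeCommutativeMonoid.
Variable X : Type.
HB.instance Definition _ := Choice.copy (F2 X) {mset {classic X}}%mset.
HB.instance Definition _ := isMonoid.Build (F2 X)
  (@msetDA {classic X}) (@mset0D {classic X}) (@msetD0 {classic X}).
Lemma F2_mulC : commutative (@monoid.mul (F2 X)).
Proof. exact: msetDC. Qed.
End FreeCommutativeMonoid.

Definition gen1 (X : Type) (x : X) : F1 X := << (x : {classic X}) >>.
Definition gen2 (X : Type) (x : X) : F2 X := [mset (x : {classic X})]%mset.

Definition F1map (X Y : Type) (f : X -> Y) : F1 X -> F1 Y :=
  fglift (fun x : {classic X} => gen1 (f x) : {freeg {classic Y}}).

Section F1map.
Variables (X Y : Type) (f : X -> Y).
Fact F1map_additive : additive (F1map f).
Proof. exact: lift_is_additive. Qed.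
HB.instance Definition _ :=
  GRing.isAdditive.Build (F1 X) (F1 Y) (F1map f) F1map_additive.
End F1map.

Lemma F1map_gen (X Y : Type) (f : X -> Y) (x : X) :
  F1map f (gen1 x) = gen1 (f x).
Proof. by rewrite /F1map /gen1 liftU scale1r. Qed.

Lemma F1_ext (X : Type) (G : zmodType) (f g : {additive F1 X -> G}) :
  (forall x, f (gen1 x) = g (gen1 x)) -> f = g.
Proof.
move=> fg; apply/additive_homP/funext => D.
rewrite -[D]freeg_sumE !raddf_sum; apply: eq_bigr => x _.
have -> : << coeff x D *g x >> = gen1 x *~ coeff x D.
  by rewrite freegU_mulz intz.
by rewrite !raddfMz /= fg.
Qed.

(* The extension of u : X -> M to F2 X. A multiset is enumerated as the       *)
(* sequence of its elements, with multiplicity; the value does not depend on  *)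
(* the order of this enumeration as soon as M is commutative.                 *)
Definition F2lift (X : Type) (M : monoidType) (u : X -> M) (A : F2 X) : M :=
  (\prod_(x <- (A : multiset {classic X})) u x)%g.

Section F2lift.
Variables (X : Type) (M : monoidType) (u : X -> M).
Hypothesis mulMC : commutative (@monoid.mul M).

Let com : Monoid.com_law (1%g : M) :=
  HB.pack (@monoid.mul M) (Monoid.isComLaw.Build M 1%g (@monoid.mul M)
    (@mulgA M) mulMC (@mul1g M)).

Lemma F2lift_monoid_morphism : monoid.monoid_morphism (F2lift u).
Proof.
split; first by rewrite /F2lift big_mset0.
move=> A B; rewrite /F2lift -big_cat; apply: (perm_big (op := com)).
by apply/allP => x _ /=; rewrite count_cat !count_mem_mset msetE2.
Qed.
End F2lift.

Lemma F2lift_gen (X : Type) (M : monoidType) (u : X -> M) (x : X) :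
  F2lift u (gen2 x) = u x.
Proof. by rewrite /F2lift /gen2 enum_msetn big_seq1. Qed.

Lemma F2_ext (X : Type) (M : monoidType) (f g : monoid_hom (F2 X) M) :
  (forall x, f (gen2 x) = g (gen2 x)) -> f = g.
Proof.
move=> fg; apply/monoid_homP/funext => A.
suff -> : A = F2lift (@gen2 X) A.
  by rewrite /F2lift !gmulf_prod; apply: eq_bigr => x _; exact: fg.
apply/msetP => x; rewrite /F2lift -count_mem_mset.
elim: {A}(enum_mset A) => [|y s IHs]; first by rewrite big_nil mset0E.
by rewrite big_cons [RHS]msetE2 /= IHs [in RHS]msetnE eq_sym; case: eqP.
Qed.

Definition F2map (X Y : Type) (f : X -> Y) : F2 X -> F2 Y :=
  F2lift (fun x => gen2 (f x)).

Section F2map.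
Variables (X Y : Type) (f : X -> Y).
Fact F2map_monoid_morphism : monoid.monoid_morphism (F2map f).
Proof. by apply: F2lift_monoid_morphism; exact: F2_mulC. Qed.
HB.instance Definition _ :=
  isUMagmaMorphism.Build (F2 X) (F2 Y) (F2map f) F2map_monoid_morphism.
End F2map.

Lemma F2map_gen (X Y : Type) (f : X -> Y) (x : X) :
  F2map f (gen2 x) = gen2 (f x).
Proof. exact: F2lift_gen. Qed.

Definition Fmap (X' X : Type) (i : X' -> X) : F2 X' -> U' (F1 X) :=
  F2lift (fun x => gen1 (i x) : U' (F1 X)).

Section Fmap.
Variables (X' X : Type) (i : X' -> X).
Fact Fmap_monoid_morphism : monoid.monoid_morphism (Fmap i).
Proof. by apply: F2lift_monoid_morphism; exact: addrC. Qed.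
HB.instance Definition _ :=
  isUMagmaMorphism.Build (F2 X') (U' (F1 X)) (Fmap i) Fmap_monoid_morphism.
End Fmap.

Lemma Fmap_gen (X' X : Type) (i : X' -> X) (x : X') :
  Fmap i (gen2 x) = gen1 (i x).
Proof. exact: F2lift_gen. Qed.

Lemma coeff_Fmap (X' X : Type) (i : X' -> X) (A : F2 X') (x : X') :
  injective i ->
  coeff (i x : {classic X}) (Fmap i A : F1 X) =
    ((A : multiset {classic X'}) x)%:R.
Proof.
move=> i_inj; rewrite -count_mem_mset /Fmap /F2lift.
elim: (enum_mset A) => [|y s IHs]; first by rewrite big_nil coeff0.
rewrite big_cons [LHS]coeffD IHs coeffU mul1r /= natrD; congr (_%:R + _).
by rewrite (inj_eq (i_inj : injective (i : {classic X'} -> {classic X}))).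
Qed.

Lemma Fmap_inj (X' X : Type) (i : X' -> X) : injective i -> injective (Fmap i).
Proof.
move=> i_inj A B eqAB; apply/msetP => x; apply/eqP; rewrite -eqz_nat -!natz.
by rewrite -!(coeff_Fmap _ _ i_inj) eqAB.
Qed.

Definition F_obj (i : setm_obj) : qabm_obj :=
  @QAbmObj (F2 (ssub i)) (F1 (samb i)) (Fmap (smap i))
    (Fmap_inj (@smap_inj i)).

Definition F_mor (i j : setm_obj) (f : setm_hom i j) :
  qabm_hom (F_obj i) (F_obj j).
Proof.
apply: (@QAbmHom (F_obj i) (F_obj j) (F1map (shom1 f)) (F2map (shom2 f))).
apply: (congr1 (@UMagmaMorphism.sort _ _) (_ : _ \o _ = _ \o _ :> monoid_hom _ _)).
apply: F2_ext => x /=; rewrite F2map_gen !Fmap_gen /U'map F1map_gen.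
by congr gen1; move/(congr1 (@^~ x)): (shomE f).
Defined.

Definition F : functor Setm QAbm.
Proof.
apply: (@Functor Setm QAbm F_obj F_mor) => [a|a b c g f]; apply: qabm_homP => /=.
- apply: (congr1 (@GRing.Additive.sort _ _) (_ : _ = idfun :> {additive _ -> _})).
  by apply: F1_ext => x /=; rewrite F1map_gen.
- apply: (congr1 (@UMagmaMorphism.sort _ _) (_ : _ = idfun :> monoid_hom _ _)).
  by apply: F2_ext => x /=; rewrite F2map_gen.
- apply: (congr1 (@GRing.Additive.sort _ _) (_ : _ = _ \o _ :> {additive _ -> _})).
  by apply: F1_ext => x /=; rewrite !F1map_gen.
- apply: (congr1 (@UMagmaMorphism.sort _ _) (_ : _ = _ \o _ :> monoid_hom _ _)).
  by apply: F2_ext => x /=; rewrite !F2map_gen.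
Defined.

(* Main.v *)
From HB Require Import structures.
From mathcomp Require Import all_boot all_algebra freeg.
From mathcomp Require Import boolp.
Require Import Defs.

Set Implicit Arguments.
Unset Strict Implicit.
Unset Printing Implicit Defensive.

Import GRing.Theory.
Local Open Scope ring_scope.

(** [F] is left adjoint to [U] because [F1 X] and [F2 X'] are free on their
    generators. A morphism from [F i] to [j : N -> U' H] restricts along
    [gen1] and [gen2] to a pair of set maps, and this pair is a square because
    [F i] sends generators to generators. In the other direction a square of
    set maps extends uniquely: [F1lift] extends the map into the abelian group
    [H], and [F2lift_hom] extends the map into [N]. The second extension needs
    [N] to be commutative, which holds since [N] embeds into [H]
    ([qsub_mulC]). The two extensions again form a square, and extending is
    inverse to restricting, because homomorphisms out of a free object agree as
    soon as they agree on generators ([F1_ext], [F2_ext]). Naturality in the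
    second variable holds by associativity of composition of functions, and in
    the first because [F] acts on generators through the given set maps. *)

Section FreeAbelianGroup.
Variables (X : Type) (G : zmodType) (u : X -> G).

(** An abelian group is a module over the integers, which is the structure that
    the linear extension [fglift] asks of its target. *)
Definition F1lift : F1 X -> G :=
  fglift (fun x : {classic X} => u x : zmodule G).

Fact F1lift_additive : additive F1lift.
Proof. exact: (@lift_is_additive _ {classic X} (zmodule G)). Qed.

HB.instance Definition _ :=
  GRing.isAdditive.Build (F1 X) G F1lift F1lift_additive.

Lemma F1lift_gen (x : X) : F1lift (gen1 x) = u x.
Proof. by rewrite /F1lift /gen1 liftU scale1r. Qed.
End FreeAbelianGroup.

Definition F2lift_hom (X : Type) (M : monoidType)
    (mulMC : commutative (@monoid.mul M)) (u : X -> M) : monoid_hom (F2 X) M :=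
  HB.pack (F2lift u)
    (isUMagmaMorphism.Build (F2 X) M (F2lift u) (F2lift_monoid_morphism u mulMC)).

(** Maps into [qsub b] extend to the free commutative monoid [F2 X] only because
    the embedding of [qsub b] into an abelian group forces commutativity. *)
Lemma qsub_mulC (b : qabm_obj) : commutative (@monoid.mul (qsub b)).
Proof.
by move=> x y; apply: (@qmap_inj b); rewrite !gmulfM; exact: addrC.
Qed.

Section Transposition.
Variables (a : setm_obj) (b : qabm_obj).

Fact transpose_square (g : qabm_hom (F_obj a) b) :
  smap (U_obj b) \o (qhom2 g \o @gen2 _) = (qhom1 g \o @gen1 _) \o smap a.
Proof.
apply/funext => x /=; rewrite -[gen1 _]Fmap_gen.
by move/(congr1 (@^~ (gen2 x))): (qhomE g).
Qed.

Definition transpose (g : qabm_hom (F_obj a) b) : setm_hom a (U_obj b) :=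
  @SetmHom a (U_obj b) (qhom1 g \o @gen1 _) (qhom2 g \o @gen2 _)
    (transpose_square g).

(** Both sides are monoid homomorphisms out of [F2 (ssub a)], so they only have
    to be compared on generators, where the equation is the square of [s]. *)
Fact untranspose_square (s : setm_hom a (U_obj b)) :
  qmap b \o F2lift_hom (@qsub_mulC b) (shom2 s)
  = U'map (F1lift (shom1 s)) \o qmap (F_obj a).
Proof.
apply: (congr1 (@UMagmaMorphism.sort _ _)
  (_ : _ \o _ = _ \o _ :> monoid_hom _ _)).
apply: F2_ext => x /=; rewrite F2lift_gen Fmap_gen /U'map F1lift_gen.
by move/(congr1 (@^~ x)): (shomE s).
Qed.

Definition untranspose (s : setm_hom a (U_obj b)) : qabm_hom (F_obj a) b :=
  @QAbmHom (F_obj a) b (F1lift (shom1 s))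
    (F2lift_hom (@qsub_mulC b) (shom2 s)) (untranspose_square s).

(** A morphism out of [F_obj a] is determined by its values on generators:
    this is the uniqueness half of the two universal properties. *)
Lemma transposeK : cancel transpose untranspose.
Proof.
move=> g; apply: qabm_homP.
- apply: (congr1 (@GRing.Additive.sort _ _)).
  by apply: F1_ext => x /=; rewrite F1lift_gen.
- apply: (congr1 (@UMagmaMorphism.sort _ _)).
  by apply: F2_ext => x /=; rewrite F2lift_gen.
Qed.

Lemma untransposeK : cancel untranspose transpose.
Proof.
move=> s; apply: setm_homP; apply/funext => x /=.
- exact: F1lift_gen.
- exact: F2lift_gen.
Qed.
End Transposition.

Theorem theorem4p3 : left_adjoint F U.
Proof.
exists transpose; split=> [a b|a a' b f g|a b b' g h].
- exact: Bijective (@transposeK a b) (@untransposeK a b).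
- apply: setm_homP; apply/funext => x /=.
  + by rewrite F1map_gen.
  + by rewrite F2map_gen.
- exact: setm_homP.
Qed.
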